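(* Let $\alpha\in[0,1]$, $k\in\{-1,0,1\}$, and let $\beta\in\mathbb{C}\setminus\{0\}$ with $\operatorname{Re}\beta>0$. Suppose $p$ is analytic in $\mathbb{D}$ with $p(0)=1$ and satisfies $$(1-\alpha)p(z)+\alpha p^2(z)+\beta\frac{zp'(z)}{p^k(z)}\prec\sqrt{1+\tanh z}.$$ Then $p(z)\prec\sqrt{1+z}$ whenever $$|\beta|\ge\left(R_0+2\alpha+(1-\alpha)\sqrt{2}\right)2^{(k+3)/2},$$ where $R_0=e\sqrt{2/(1+e^2)}\simeq 1.32725$.
   Context: $\mathbb{D}$ is the open unit disk in $\mathbb{C}$. For functions $f,g$ analytic in $\mathbb{D}$, $f\prec g$ ($f$ is subordinate to $g$) means that there is an analytic $w:\mathbb{D}\to\mathbb{D}$ with $w(0)=0$ and $f=g\circ w$. Square roots are principal branches. The subordination hypothesis includes that its left-hand side is analytic in $\mathbb{D}$. *)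

(* Defs.v *)
From Stdlib Require Import Reals ZArith Lra.
From Coquelicot Require Import Coquelicot.

Open Scope R_scope.

Definition in_disk (z : C) : Prop := Cmod z < 1.

(* The unit disk is open, so complex differentiability at each of its points is
   analyticity.  Functions are total on C; values off the disk play no role. *)
Definition analytic_on_disk (f : C -> C) : Prop :=
  forall z : C, in_disk z ->
    ex_derive (K := C_AbsRing) (V := C_NormedModule) f z.

Definition subordinate (f g : C -> C) : Prop :=
  analytic_on_disk f /\ analytic_on_disk g /\
  exists w : C -> C,
    analytic_on_disk w /\
    (forall z : C, in_disk z -> in_disk (w z)) /\
    w (RtoC 0) = RtoC 0 /\
    (forall z : C, in_disk z -> f z = g (w z)).

Definition Cexp (z : C) : C :=
  (exp (Re z) * cos (Im z), exp (Re z) * sin (Im z)).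

Definition Ctanh (z : C) : C :=
  ((Cexp z - Cexp (- z)) / (Cexp z + Cexp (- z)))%C.

(* Principal square root in Cartesian coordinates; [Csqrt_sqr], [Csqrt_Re] and
   [Csqrt_Im] pin it down as the root with argument in (-PI/2, PI/2]. *)
Definition Csqrt (z : C) : C :=
  (sqrt ((Cmod z + Re z) / 2),
   (if Rlt_dec (Im z) 0 then -1 else 1) * sqrt ((Cmod z - Re z) / 2)).

Lemma Csqrt_sqr (z : C) : (Csqrt z * Csqrt z)%C = z.
Proof.
pose proof (re_le_Cmod z) as Hre; apply Rabs_le_between in Hre.
assert (Hp : 0 <= (Cmod z + Re z) / 2) by lra.
assert (Hm : 0 <= (Cmod z - Re z) / 2) by lra.
pose proof (sqrt_sqrt _ Hp) as Sp; pose proof (sqrt_sqrt _ Hm) as Sm.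
assert (Hpm : sqrt ((Cmod z + Re z) / 2) * sqrt ((Cmod z - Re z) / 2)
              = Rabs (Im z) / 2).
{ rewrite <- sqrt_mult by assumption.
  replace ((Cmod z + Re z) / 2 * ((Cmod z - Re z) / 2))
    with (Rsqr (Im z / 2)).
  - rewrite sqrt_Rsqr_abs; unfold Rdiv; rewrite Rabs_mult.
    rewrite (Rabs_pos_eq (/ 2)) by lra; reflexivity.
  - pose proof (Cmod2_alt z) as H; unfold Rsqr; nra. }
unfold Csqrt; destruct z as [x y]; unfold Cmult; simpl in *.
revert Sp Sm Hpm.
generalize (sqrt ((Cmod (x, y) + x) / 2)) (sqrt ((Cmod (x, y) - x) / 2)).
intros a b Sp Sm Hpm.
destruct (Rlt_dec y 0) as [Hy | Hy].
- rewrite Rabs_left in Hpm by assumption; f_equal; nra.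
- rewrite Rabs_pos_eq in Hpm by lra; f_equal; nra.
Qed.

Lemma Csqrt_Re (z : C) : 0 <= Re (Csqrt z).
Proof. apply sqrt_pos. Qed.

Lemma Csqrt_Im (z : C) : Re (Csqrt z) = 0 -> 0 <= Im (Csqrt z).
Proof.
intros H.
pose proof (Csqrt_sqr z) as Hs; apply (f_equal Im) in Hs.
rewrite im_mult, H in Hs.
unfold Csqrt; simpl.
destruct (Rlt_dec (Im z) 0) as [Hz | Hz]; [exfalso; lra |].
rewrite Rmult_1_l; apply sqrt_pos.
Qed.

Definition CpowZ (z : C) (k : Z) : C :=
  match k with
  | Z0 => RtoC 1
  | Zpos n => (z ^ Pos.to_nat n)%C
  | Zneg n => (/ z ^ Pos.to_nat n)%C
  end.

(* Since [/ 0 = 0] in C, dividing by [CpowZ (p z) (-1)] is multiplying by [p z]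
   even where p vanishes.  For k = 1 a zero of p is a genuine pole of the
   mathematical expression, and the total function below is discontinuous
   there, so it is analytic in the disk only if p has no zero. *)
Definition lhs (alpha : R) (beta : C) (k : Z) (p : C -> C) (z : C) : C :=
  (RtoC (1 - alpha) * p z + RtoC alpha * (p z) ^ 2
   + beta * ((z * C_derive p z) / CpowZ (p z) k))%C.

Definition R_tanh : R := exp 1 * sqrt (2 / (1 + exp 1 ^ 2)).

(* Main.v *)
(* Put w = p^2 - 1.  If |w| reaches 1 in the disk, let z0 be a point of smallest modulus where it
   does; Jack's lemma gives z0 w'(z0) = m w(z0) with m >= 1, so that at P = p(z0) the left-hand
   side of the hypothesis equals (1-alpha) P + alpha P^2 + beta m (P^2 - 1) / (2 P^(k+1)).

   The modulus of sqrt (1 + tanh) on the disk is not bounded by R_0 (at z = i it tends to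
   (cos 1)^(-1/2) = 1.36 > R_0, and the supremum is about 1.44), so the triangle inequality alone is
   not enough.  The gap is closed by Re beta > 0: |beta + u| >= |beta| - |u - t| for every t >= 0, and
   unless |P| is small (when t = 0 will do) t > 0 can be chosen so that the left-hand side exceeds
   3/2, a bound for |sqrt (1 + tanh)|.

   Schwarz's lemma, needed for m >= 1, is obtained without Cauchy's theorem.  The hypothesis expresses
   z w'(z) through p and the left-hand side, which are both analytic; hence w is twice complex
   differentiable off 0, and Re (c w(z)/z) + e (ln |z|^2 + |z|^2) has Laplacian 4 e > 0 there and
   tends to -oo at 0, so its maximum over |z| <= r is attained on |z| = r. *)

Require Import Defs.
From Stdlib Require Import Reals ZArith Lra Lia Classical ClassicalEpsilon Ranalysis5.
From Coquelicot Require Import Coquelicot.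
Open Scope R_scope.

(** * Complex differentiability *)

(** Increment form of the complex derivative, written with [Cmod] so that the estimates below are
    free of filters; [h = 0] is harmless, both sides being 0 there. *)
Definition cdiff (f : C -> C) (z l : C) : Prop :=
  forall e, 0 < e -> exists d, 0 < d /\
    forall h, Cmod h < d -> Cmod (f (z + h) - f z - l * h)%C <= e * Cmod h.

Lemma cdiff_is_derive (f : C -> C) (z l : C) :
  cdiff f z l <-> is_derive (K := C_AbsRing) (V := C_NormedModule) f z l.
Proof.
split.
- intros H; split; [apply is_linear_scal_l|].
  intros x Hx e.
  apply (is_filter_lim_locally_unique (K:=C_AbsRing) (V:=AbsRing_NormedModule C_AbsRing)) in Hx; subst x.
  destruct (H e (cond_pos e)) as [d [Hd H']].
  exists (mkposreal d Hd); intros y Hy.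
  specialize (H' (y - z)%C Hy). revert H'. clear Hy. revert y.
  change (forall y : C, Cmod (f (z + (y - z)) - f z - l * (y - z))%C <= e * Cmod (y - z) ->
    Cmod (f y - f z - (y - z) * l)%C <= e * Cmod (y - z)).
  intros y; replace (z + (y - z))%C with y by ring.
  replace (l * (y - z))%C with ((y - z) * l)%C by ring. trivial.
- intros [_ H] e He.
  destruct (H z (fun P HP => HP) (mkposreal e He)) as [d Hd].
  exists d; split; [apply cond_pos|].
  intros h Hh.
  assert (Hb : ball (M := AbsRing_UniformSpace C_AbsRing) z d (z + h)%C).
  { change (Cmod (z + h - z) < d). replace (z + h - z)%C with h by ring; exact Hh. }
  specialize (Hd _ Hb).
  unfold minus, plus, opp, scal in Hd; simpl in Hd; unfold mult in Hd; simpl in Hd.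
  change (Cmod (f (z + h) + - f z + - ((z + h + - z) * l))%C <= e * Cmod (z + h + - z)) in Hd.
  replace (z + h + - z)%C with h in Hd by ring.
  replace (f (z + h) + - f z + - (h * l))%C with (f (z + h) - f z - l * h)%C in Hd by ring.
  exact Hd.
Qed.

Lemma cdiff_lip f z l : cdiff f z l ->
  exists d, 0 < d /\ forall h, Cmod h < d -> Cmod (f (z + h) - f z)%C <= (Cmod l + 1) * Cmod h.
Proof.
intros H; destruct (H 1 Rlt_0_1) as [d [Hd H1]].
exists d; split; [exact Hd|]; intros h Hh.
specialize (H1 h Hh).
replace (f (z + h) - f z)%C with ((f (z + h) - f z - l * h) + l * h)%C by ring.
eapply Rle_trans; [apply Cmod_triangle|]. rewrite Cmod_mult; lra.
Qed.

Lemma cdiff_cont f z l : cdiff f z l ->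
  forall e, 0 < e -> exists d, 0 < d /\ forall h, Cmod h < d -> Cmod (f (z + h) - f z)%C < e.
Proof.
intros H e He; destruct (cdiff_lip f z l H) as [d [Hd H1]].
pose proof (Cmod_ge_0 l) as Hl.
exists (Rmin d (e / (Cmod l + 1))); split.
- apply Rmin_glb_lt; [exact Hd|apply Rdiv_lt_0_compat; lra].
- intros h Hh. eapply Rle_lt_trans; [apply H1; eapply Rlt_le_trans; [exact Hh|apply Rmin_l]|].
  apply Rlt_le_trans with ((Cmod l + 1) * (e / (Cmod l + 1))); [|right; field; lra].
  apply Rmult_lt_compat_l; [lra|]. eapply Rlt_le_trans; [exact Hh|apply Rmin_r].
Qed.

Lemma cdiff_ext_loc f g z l r : 0 < r ->
  (forall h, Cmod h < r -> f (z + h)%C = g (z + h)%C) -> cdiff f z l -> cdiff g z l.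
Proof.
intros Hr E H e He; destruct (H e He) as [d [Hd H1]].
exists (Rmin d r); split; [apply Rmin_glb_lt; assumption|].
intros h Hh.
assert (E0 : f z = g z).
{ replace z with (z + RtoC 0)%C by ring. apply E. rewrite Cmod_0; exact Hr. }
rewrite <- E0, <- E by (eapply Rlt_le_trans; [exact Hh|apply Rmin_r]).
apply H1. eapply Rlt_le_trans; [exact Hh|apply Rmin_l].
Qed.

Lemma cdiff_const c z : cdiff (fun _ => c) z 0.
Proof.
intros e He; exists 1; split; [lra|]; intros h _.
replace (c - c - 0 * h)%C with (RtoC 0) by ring.
rewrite Cmod_0; pose proof (Cmod_ge_0 h); nra.
Qed.

Lemma cdiff_plus f g z l m : cdiff f z l -> cdiff g z m -> cdiff (fun x => f x + g x)%C z (l + m).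
Proof.
intros H1 H2 e He.
destruct (H1 (e / 2)) as [d1 [Hd1 K1]]; [lra|].
destruct (H2 (e / 2)) as [d2 [Hd2 K2]]; [lra|].
exists (Rmin d1 d2); split; [apply Rmin_glb_lt; assumption|]; intros h Hh.
specialize (K1 h (Rlt_le_trans _ _ _ Hh (Rmin_l _ _))).
specialize (K2 h (Rlt_le_trans _ _ _ Hh (Rmin_r _ _))).
replace (f (z + h) + g (z + h) - (f z + g z) - (l + m) * h)%C with
 ((f (z + h) - f z - l * h) + (g (z + h) - g z - m * h))%C by ring.
eapply Rle_trans; [apply Cmod_triangle|]. lra.
Qed.

Lemma cdiff_mult f g z l m : cdiff f z l -> cdiff g z m ->
  cdiff (fun x => f x * g x)%C z (l * g z + f z * m).
Proof.
intros H1 H2 e He.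
pose proof (Cmod_ge_0 (f z)) as Hf. pose proof (Cmod_ge_0 (g z)) as Hg. pose proof (Cmod_ge_0 l) as Hl.
(* The error of the product splits into three terms, each given a third of [e * Cmod h]; the [+ 1]
   keeps the denominators positive. *)
assert (P1 : 0 < e / (3 * (Cmod (g z) + 1))) by (apply Rdiv_lt_0_compat; lra).
assert (P2 : 0 < e / (3 * (Cmod (f z) + 1))) by (apply Rdiv_lt_0_compat; lra).
assert (P3 : 0 < e / (3 * (Cmod l + 1))) by (apply Rdiv_lt_0_compat; lra).
destruct (cdiff_lip f z l H1) as [d3 [Hd3 K3]].
destruct (H1 _ P1) as [d1 [Hd1 K1]].
destruct (H2 _ P2) as [d2 [Hd2 K2]].
destruct (cdiff_cont g z m H2 _ P3) as [d4 [Hd4 K4]].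
exists (Rmin (Rmin d1 d2) (Rmin d3 d4)); split; [repeat apply Rmin_glb_lt; assumption|]; intros h Hh.
apply Rmin_Rgt in Hh; destruct Hh as [Ha Hb].
apply Rmin_Rgt in Ha; apply Rmin_Rgt in Hb.
specialize (K1 h (proj1 Ha)). specialize (K2 h (proj2 Ha)).
specialize (K3 h (proj1 Hb)). specialize (K4 h (proj2 Hb)).
replace (f (z + h) * g (z + h) - f z * g z - (l * g z + f z * m) * h)%C with
 ((f (z + h) - f z - l * h) * g z + f z * (g (z + h) - g z - m * h)
  + (f (z + h) - f z) * (g (z + h) - g z))%C by ring.
eapply Rle_trans; [apply Cmod_triangle|].
eapply Rle_trans; [apply Rplus_le_compat_r, Cmod_triangle|].
rewrite !Cmod_mult.
revert K1 K2 K3 K4.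
generalize (Cmod (f (z + h) - f z - l * h)%C) (Cmod (g (z + h) - g z - m * h)%C).
intros a b K1 K2.
pose proof (Cmod_ge_0 (f (z + h) - f z)%C) as Hc. pose proof (Cmod_ge_0 (g (z + h) - g z)%C) as Hd.
revert Hc Hd.
generalize (Cmod (f (z + h) - f z)%C) (Cmod (g (z + h) - g z)%C).
intros c d Hc Hd K3 K4.
pose proof (Cmod_ge_0 h) as Hh.
assert (T : forall A B x, 0 <= A -> 0 < B -> 0 <= x -> x <= B -> x * (A / (3 * (B))) <= A / 3).
{ intros A B x HA HB Hx HxB. replace (A / 3) with (B * (A / (3 * B))) by (field; lra).
  apply Rmult_le_compat_r; [|lra]. apply Rmult_le_pos; [lra|left; apply Rinv_0_lt_compat; lra]. }
assert (Q1 : a * Cmod (g z) <= e / 3 * Cmod h).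
{ apply Rle_trans with (Cmod (g z) * (e / (3 * (Cmod (g z) + 1))) * Cmod h).
  - apply (Rmult_le_compat_l (Cmod (g z))) in K1; lra.
  - apply Rmult_le_compat_r; [exact Hh|]. apply T; lra. }
assert (Q2 : Cmod (f z) * b <= e / 3 * Cmod h).
{ apply Rle_trans with (Cmod (f z) * (e / (3 * (Cmod (f z) + 1))) * Cmod h).
  - apply (Rmult_le_compat_l (Cmod (f z))) in K2; lra.
  - apply Rmult_le_compat_r; [exact Hh|]. apply T; lra. }
assert (Q3 : c * d <= e / 3 * Cmod h).
{ apply Rle_trans with (((Cmod l + 1) * Cmod h) * (e / (3 * (Cmod l + 1)))).
  - apply Rmult_le_compat; lra.
  - pose proof (T e (Cmod l + 1) (Cmod l + 1)) as T'.
    apply Rle_trans with ((Cmod l + 1) * (e / (3 * (Cmod l + 1))) * Cmod h); [right; ring|].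
    apply Rmult_le_compat_r; [exact Hh|]. apply T'; lra. }
lra.
Qed.

Lemma cdiff_inv (z : C) : z <> RtoC 0 -> cdiff Cinv z (- (/ z * / z)).
Proof.
intros Hz e He.
pose proof (Cmod_gt_0 z) as [Hp _]; specialize (Hp Hz).
(* The error is exactly [h^2 / (z^2 (z + h))]. The first radius gives [|z + h| >= |z| / 2], the
   second then bounds the error by [e |h|]. *)
exists (Rmin (Cmod z / 2) (e * Cmod z ^ 3 / 2)); split.
{ apply Rmin_glb_lt; [lra|]. apply Rdiv_lt_0_compat; [|lra]. apply Rmult_lt_0_compat; [lra|apply pow_lt; lra]. }
intros h Hh. apply Rmin_Rgt in Hh; destruct Hh as [Ha Hb].
assert (Hzh : Cmod z / 2 <= Cmod (z + h)).
{ pose proof (Cmod_triangle (z + h) (- h)) as T. rewrite Cmod_opp in T.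
  replace (z + h + - h)%C with z in T by ring. lra. }
assert (Hn : (z + h)%C <> RtoC 0). { intros E; rewrite E, Cmod_0 in Hzh; lra. }
replace (/ (z + h) - / z - - (/ z * / z) * h)%C with (h * h / (z * z * (z + h)))%C by (field; auto).
rewrite Cmod_div by (repeat apply Cmult_neq_0; assumption).
rewrite !Cmod_mult.
apply Rle_trans with (Cmod h * Cmod h / (Cmod z * Cmod z * (Cmod z / 2))).
- apply Rmult_le_compat_l; [apply Rmult_le_pos; apply Cmod_ge_0|].
  apply Rinv_le_contravar; [repeat apply Rmult_lt_0_compat; lra|].
  apply Rmult_le_compat_l; [nra|exact Hzh].
- pose proof (Cmod_ge_0 h).
  apply Rle_trans with (e * Cmod z ^ 3 / 2 * Cmod h / (Cmod z * Cmod z * (Cmod z / 2))); [|right; field; lra].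
  apply Rmult_le_compat_r; [left; apply Rinv_0_lt_compat; repeat apply Rmult_lt_0_compat; lra|].
  apply Rmult_le_compat_r; lra.
Qed.

(** * The extreme value theorem in the plane *)

(** The third hypothesis is closedness of [K], the fourth upper semicontinuity of [f] on [K].
    Compactness is used twice: to bound [f] above, and to lower a supremum that is not attained. *)
Lemma EVT_plane (K : C -> Prop) (f : C -> R) (B : R) (z0 : C) :
  K z0 ->
  (forall z, K z -> Cmod z <= B) ->
  (forall z, ~ K z -> exists d, 0 < d /\ forall h, Cmod h < d -> ~ K (z + h)%C) ->
  (forall z, K z -> forall e, 0 < e -> exists d, 0 < d /\
     forall h, Cmod h < d -> K (z + h)%C -> f (z + h)%C < f z + e) ->
  exists z, K z /\ forall z', K z' -> f z' <= f z.
Proof.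
intros Kz0 HB Hcl Hf.
assert (Box : forall z, K z -> (- B <= fst z <= B) /\ (- B <= snd z <= B)).
{ intros z Kz. specialize (HB z Kz). pose proof (Rmax_Cmod z) as M.
  pose proof (Rmax_l (Rabs (fst z)) (Rabs (snd z))). pose proof (Rmax_r (Rabs (fst z)) (Rabs (snd z))).
  split; apply Rabs_le_between; lra. }
(* Compactness: a bound that holds locally with some [d], and then with every smaller one, holds
   with a single [d]. *)
assert (U : forall P : R -> C -> Prop,
  (forall d d' z, 0 < d' <= d -> P d z -> P d' z) ->
  (forall z, K z -> exists d, 0 < d /\ forall h, Cmod h < d -> K (z + h)%C -> P d (z + h)%C) ->
  exists d, 0 < d /\ forall z, K z -> P d z).
{ intros P Pm Pl.
  assert (L : forall z, exists d, 0 < d /\ forall h, Cmod h < d -> K (z + h)%C -> P d (z + h)%C).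
  { intros z; destruct (classic (K z)) as [Kz|Kz]; [apply Pl, Kz|].
    destruct (Hcl z Kz) as [d [Hd H]]. exists d; split; [exact Hd|].
    intros h Hh Kh; exfalso; apply (H h Hh Kh). }
  (* The covering lemma works with squares; one of half-side [d] lies in the disc of radius [2 d]
     because [sqrt 2 < 2]. Its gauge has to be a function, hence the choice of a [d] at every
     point. *)
  assert (L' : forall u v : R, {d : posreal | forall h, Cmod h < 2 * d -> K ((u, v) + h)%C -> P d ((u, v) + h)%C}).
  { intros u v. apply constructive_indefinite_description.
    destruct (L (u, v)) as [d [Hd H]].
    assert (Hd2 : 0 < d / 2) by lra.
    exists (mkposreal _ Hd2); simpl; intros h Hh Kh.
    apply Pm with d; [lra|]. apply H; [lra|exact Kh]. }
  destruct (compactness_value_2d (- B) B (- B) B (fun u v => proj1_sig (L' u v))) as [d Hd].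
  exists d; split; [apply cond_pos|]. intros [x y] Kz.
  apply NNPP; intros N.
  destruct (Box _ Kz) as [B1 B2]; simpl in B1, B2.
  apply (Hd x y B1 B2); intros [u [v [_ [_ [Hu [Hv Hl]]]]]].
  apply N. destruct (L' u v) as [d' Hd']; simpl in *.
  apply Pm with d'; [split; [apply cond_pos|exact Hl]|].
  replace (x, y) with ((u, v) + ((x - u)%R, (y - v)%R))%C by (apply injective_projections; simpl; ring).
  apply Hd'.
  - eapply Rle_lt_trans; [apply Cmod_2Rmax|]; simpl.
    assert (M : Rmax (Rabs (x - u)) (Rabs (y - v)) < d') by (apply Rmax_lub_lt; assumption).
    assert (S : sqrt 2 < 2).
    { rewrite <- (sqrt_Rsqr 2) at 2 by lra. apply sqrt_lt_1; unfold Rsqr; lra. }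
    pose proof (sqrt_pos 2). pose proof (Rabs_pos (x - u)). pose proof (Rmax_l (Rabs (x - u)) (Rabs (y - v))).
    nra.
  - replace ((u, v) + ((x - u)%R, (y - v)%R))%C with (x, y) by (apply injective_projections; simpl; ring). exact Kz. }
assert (Bd : bound (fun r => exists z, K z /\ r = f z)).
{ destruct (U (fun d z => f z <= / d)) as [d [Hd H]].
  - intros d d' z Hd H. apply Rle_trans with (/ d); [exact H|apply Rinv_le_contravar; lra].
  - intros z Kz. destruct (Hf z Kz 1 Rlt_0_1) as [d [Hd H]].
    assert (Q : 0 < / (Rabs (f z) + 1)) by (apply Rinv_0_lt_compat; pose proof (Rabs_pos (f z)); lra).
    exists (Rmin d (/ (Rabs (f z) + 1))); split; [apply Rmin_glb_lt; assumption|].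
    intros h Hh Kh. apply Rmin_Rgt in Hh.
    apply Rle_trans with (Rabs (f z) + 1).
    + specialize (H h (proj1 Hh) Kh). pose proof (Rle_abs (f z)); lra.
    + eapply Rle_trans; [right; symmetry; apply Rinv_inv|]. apply Rinv_le_contravar; [apply Rmin_glb_lt; assumption|apply Rmin_r].
  - exists (/ d). intros r [z [Kz ->]]. apply H, Kz. }
destruct (completeness _ Bd) as [M [HM1 HM2]]; [exists (f z0), z0; auto|].
apply NNPP; intros N.
assert (Lt : forall z, K z -> f z < M).
{ intros z Kz. destruct (Rle_lt_or_eq_dec (f z) M) as [Hl|He]; [apply HM1; exists z; auto|exact Hl|].
  exfalso; apply N; exists z; split; [exact Kz|]. intros z' Kz'. rewrite He; apply HM1; exists z'; auto. }
(* If [M] is not attained, [M - f] is locally bounded below by a positive number; [U] makes the gap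
   uniform, and [M - d] is still an upper bound. *)
destruct (U (fun d z => f z <= M - d)) as [d [Hd H]].
- intros d d' z Hd H; lra.
- intros z Kz. pose proof (Lt z Kz) as Hl.
  destruct (Hf z Kz ((M - f z) / 2)) as [d [Hd H]]; [lra|].
  exists (Rmin d ((M - f z) / 2)); split; [apply Rmin_glb_lt; lra|].
  intros h Hh Kh. apply Rmin_Rgt in Hh. specialize (H h (proj1 Hh) Kh).
  pose proof (Rmin_r d ((M - f z) / 2)); lra.
- assert (M <= M - d); [|lra]. apply HM2. intros r [z [Kz ->]]. apply H, Kz.
Qed.

(** * A maximum principle *)

(** At the maximum [f1 0 = 0]. If [l > 0], then [f1] is positive just to the right of 0, and the
    mean value theorem gives [f s > f 0] for a small [s > 0]. *)
Lemma second_derivative_test (f f1 : R -> R) (l r : R) :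
  0 < r -> (forall t, Rabs t < r -> is_derive f t (f1 t)) -> is_derive f1 0 l ->
  (forall t, Rabs t < r -> f t <= f 0) -> l <= 0.
Proof.
intros Hr D D1 M.
assert (D0 : derivable_pt_lim f 0 (f1 0)).
{ apply is_derive_Reals, D. rewrite Rabs_R0; exact Hr. }
assert (Z : f1 0 = 0).
{ transitivity (derive_pt f 0 (exist _ (f1 0) D0)); [reflexivity|].
  apply (deriv_maximum f (- r) r); [lra|lra|].
  intros x H1 H2; apply M, Rabs_def1; lra. }
apply Rnot_lt_le; intros Hl.
apply is_derive_Reals in D1. destruct (D1 l Hl) as [d Hd].
set (s := Rmin (d / 2) (r / 2)).
assert (Hs : 0 < s <= d / 2 /\ s <= r / 2).
{ pose proof (cond_pos d). unfold s; repeat split; [apply Rmin_glb_lt; lra|apply Rmin_l|apply Rmin_r]. }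
destruct (MVT_cor2 f f1 0 s) as [c [Hc1 Hc2]]; [lra| |].
- intros c Hc. apply is_derive_Reals, D. rewrite Rabs_pos_eq; lra.
- assert (Hf : f1 c > 0).
  { assert (Hcd : Rabs c < d) by (rewrite Rabs_pos_eq; lra).
    specialize (Hd c (not_eq_sym (Rlt_not_eq _ _ (proj1 Hc2))) Hcd).
    rewrite Rplus_0_l, Z, Rminus_0_r in Hd. apply Rabs_def2 in Hd.
    replace (f1 c) with (f1 c / c * c) by (field; lra).
    apply Rmult_lt_0_compat; lra. }
  assert (f s <= f 0) by (apply M; rewrite Rabs_pos_eq; lra).
  nra.
Qed.

Lemma cdiff_dir (G : C -> C) (z d l : C) (t : R) : cdiff G (z + t * d)%C l ->
  is_derive (fun s : R => Re (G (z + s * d)%C)) t (Re (l * d)%C).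
Proof.
intros H. apply is_derive_Reals. intros e He.
pose proof (Cmod_ge_0 d) as Hd0.
destruct (H (e / (2 * (Cmod d + 1)))) as [r [Hr K]]; [apply Rdiv_lt_0_compat; lra|].
assert (Hr' : 0 < r / (Cmod d + 1)) by (apply Rdiv_lt_0_compat; lra).
exists (mkposreal _ Hr'); intros h Hh Hhr; simpl in Hhr.
assert (Hm : Cmod (h * d)%C = Rabs h * Cmod d) by (rewrite Cmod_mult, Cmod_R; reflexivity).
assert (Hp : 0 < Rabs h) by (apply Rabs_pos_lt, Hh).
assert (Hlt : Cmod (h * d)%C < r).
{ rewrite Hm. apply Rle_lt_trans with (Rabs h * (Cmod d + 1)); [nra|].
  apply (Rmult_lt_compat_r (Cmod d + 1)) in Hhr; [|lra].
  replace (r / (Cmod d + 1) * (Cmod d + 1)) with r in Hhr by (field; lra). exact Hhr. }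
specialize (K _ Hlt).
replace (z + t * d + h * d)%C with (z + (t + h)%R * d)%C in K by (rewrite RtoC_plus; ring).
pose proof (re_le_Cmod (G (z + (t + h)%R * d) - G (z + t * d) - l * (h * d))%C) as R1.
replace (Re (G (z + (t + h)%R * d) - G (z + t * d) - l * (h * d))%C) with
  ((Re (G (z + (t + h)%R * d)%C) - Re (G (z + t * d)%C)) - h * Re (l * d)%C) in R1.
2:{ replace (l * (h * d))%C with (h * (l * d))%C by ring. unfold Cminus. rewrite !re_plus, !re_opp, re_scal_l. ring. }
revert K R1.
generalize (Re (G (z + (t + h)%R * d)%C) - Re (G (z + t * d)%C)) (Re (l * d)%C). intros a b K R1.
replace (a / h - b) with ((a - h * b) / h) by (field; exact Hh).
rewrite Rabs_div by exact Hh.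
assert (Q : Rabs (a - h * b) <= e / 2 * Rabs h).
{ eapply Rle_trans; [exact R1|]. eapply Rle_trans; [exact K|]. rewrite Hm.
  apply Rle_trans with (e / (2 * (Cmod d + 1)) * (Rabs h * (Cmod d + 1))).
  - apply Rmult_le_compat_l; [left; apply Rdiv_lt_0_compat; lra|nra].
  - right; field; lra. }
apply Rle_lt_trans with (e / 2 * Rabs h / Rabs h).
- apply Rmult_le_compat_r; [left; apply Rinv_0_lt_compat; exact Hp|exact Q].
- replace (e / 2 * Rabs h / Rabs h) with (e / 2) by (field; lra). lra.
Qed.

Lemma Cplus_opp_cancel (u v : C) : (u + v + - v)%C = u.
Proof. ring. Qed.

Lemma Cplus_0_mult (u v : C) : (u + 0%R * v)%C = u.
Proof. ring. Qed.

Definition sqmod (z : C) : R := fst z ^ 2 + snd z ^ 2.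

Lemma sqmod_Cmod z : sqmod z = Cmod z ^ 2.
Proof. rewrite Cmod2_alt; reflexivity. Qed.

Definition barrier (G : C -> C) (e : R) (z : C) : R :=
  Re (G z) + e * (ln (sqmod z) + sqmod z).

(** The left-hand side is the second derivative at [t = 0] of the barrier along [z + t d];
    [r <= Cmod z] keeps that segment away from the singularity of the logarithm. *)
Lemma barrier_second (G G1 : C -> C) (z d l : C) (r e : R) :
  0 < r <= Cmod z -> Cmod d = 1 ->
  (forall h, Cmod h < r -> cdiff G (z + h)%C (G1 (z + h)%C)) -> cdiff G1 z l ->
  (forall h, Cmod h < r -> barrier G e (z + h)%C <= barrier G e z) ->
  Re (l * d * d)%C + e * (2 / sqmod z - (2 * (fst z * fst d + snd z * snd d) / sqmod z) ^ 2 + 2) <= 0.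
Proof.
intros Hr Hd D D1 M.
destruct z as [x y], d as [a b].
assert (Hab : a ^ 2 + b ^ 2 = 1).
{ change (sqmod (a, b) = 1). rewrite sqmod_Cmod, Hd; ring. }
set (N := fun t : R => (x + t * a) ^ 2 + (y + t * b) ^ 2).
assert (Hdir : forall t : R, Rabs t < r -> Cmod (t * (a, b))%C < r).
{ intros t Ht. rewrite Cmod_mult, Hd, Cmod_R; lra. }
assert (HN : forall t : R, sqmod ((x, y) + t * (a, b))%C = N t).
{ intros t; unfold sqmod, N; simpl; ring. }
assert (HNp : forall t : R, Rabs t < r -> 0 < N t).
{ intros t Ht. rewrite <- HN, sqmod_Cmod. apply pow_lt.
  pose proof (Cmod_triangle ((x, y) + t * (a, b)) (- (t * (a, b)))) as T.
  rewrite Cmod_opp in T. specialize (Hdir t Ht).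
  rewrite Cplus_opp_cancel in T. lra. }
simpl fst in *; simpl snd in *.
set (f1 := fun t : R => Re (G1 ((x, y) + t * (a, b)) * (a, b))%C
   + e * (2 * ((x + t * a) * a + (y + t * b) * b) / N t + 2 * ((x + t * a) * a + (y + t * b) * b))).
apply (second_derivative_test (fun t : R => barrier G e ((x, y) + t * (a, b))%C) f1 _ r (proj1 Hr)).
- intros t Ht. unfold barrier, f1.
  apply (is_derive_plus (K := R_AbsRing) (V := R_NormedModule)).
  + apply cdiff_dir, D, Hdir, Ht.
  + apply (is_derive_ext (fun t => e * (ln (N t) + N t))); [intros s; rewrite HN; reflexivity|].
    pose proof (HNp t Ht) as P. unfold N in *.
    auto_derive; [exact P|]. field. lra.
- unfold f1. apply (is_derive_plus (K := R_AbsRing) (V := R_NormedModule)).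
  + apply (cdiff_dir (fun z => (G1 z * (a, b))%C) (x, y) (a, b) (l * (a, b)) 0).
    rewrite Cplus_0_mult.
    replace (l * (a, b))%C with (l * (a, b) + G1 (x, y) * 0)%C by ring.
    apply (cdiff_mult G1 (fun _ => (a, b))); [exact D1|apply cdiff_const].
  + assert (P : 0 < N 0) by (apply HNp; rewrite Rabs_R0; lra).
    unfold N in *. auto_derive; [lra|].
    unfold sqmod; simpl fst; simpl snd.
    replace ((x + 0 * a) ^ 2 + (y + 0 * b) ^ 2) with (x ^ 2 + y ^ 2) in P by ring.
    transitivity (e * (2 * (a ^ 2 + b ^ 2) / (x ^ 2 + y ^ 2) - (2 * (x * a + y * b) / (x ^ 2 + y ^ 2)) ^ 2 + 2 * (a ^ 2 + b ^ 2))).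
    * field; lra.
    * rewrite Hab; field; lra.
- intros t Ht.
  rewrite Cplus_0_mult.
  apply M, Hdir, Ht.
Qed.

(** Adding [barrier_second] for the directions [1] and [Ci] takes the Laplacian: the terms in [l]
    cancel because [Ci * Ci = -1], the logarithm contributes nothing, and [4 * e <= 0] would
    remain. *)
Lemma barrier_no_max (G G1 : C -> C) (z l : C) (r e : R) :
  0 < r <= Cmod z -> 0 < e ->
  (forall h, Cmod h < r -> cdiff G (z + h)%C (G1 (z + h)%C)) -> cdiff G1 z l ->
  ~ (forall h, Cmod h < r -> barrier G e (z + h)%C <= barrier G e z).
Proof.
intros Hr He D D1 M.
pose proof (barrier_second G G1 z 1 l r e Hr Cmod_1 D D1 M) as A1.
assert (Ci1 : Cmod Ci = 1) by (unfold Cmod, Ci; simpl fst; simpl snd; replace (0 ^ 2 + 1 ^ 2) with 1 by ring; apply sqrt_1).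
pose proof (barrier_second G G1 z Ci l r e Hr Ci1 D D1 M) as A2.
replace (l * Ci * Ci)%C with (- l)%C in A2 by (destruct l; unfold Cmult, Ci, Copp; simpl; f_equal; ring).
replace (l * 1 * 1)%C with l in A1 by ring.
rewrite re_opp in A2.
assert (P : 0 < sqmod z) by (rewrite sqmod_Cmod; apply pow_lt; lra).
assert (E : 2 / sqmod z - (2 * (fst z * 1 + snd z * 0) / sqmod z) ^ 2 + 2
  + (2 / sqmod z - (2 * (fst z * 0 + snd z * 1) / sqmod z) ^ 2 + 2) = 4).
{ unfold sqmod in *. field; lra. }
simpl in A1, A2, E. nra.
Qed.

(** * Schwarz's and Jack's lemmas *)

Lemma Cmod_shift (z h : C) : Cmod z - Cmod h <= Cmod (z + h) <= Cmod z + Cmod h.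
Proof.
split; [|apply Cmod_triangle].
pose proof (Cmod_triangle (z + h) (- h)) as T.
rewrite Cplus_opp_cancel, Cmod_opp in T. lra.
Qed.

Lemma barrier_usc (G : C -> C) (z l : C) (e : R) : 0 < e -> 0 < Cmod z -> cdiff G z l ->
  forall t, 0 < t -> exists d, 0 < d /\ forall h, Cmod h < d ->
    barrier G e (z + h)%C < barrier G e z + t.
Proof.
intros He Hz D t Ht.
destruct (cdiff_cont G z l D (t / 2)) as [d1 [Hd1 K1]]; [lra|].
(* The part of the barrier without [G] depends on [Cmod z] alone, so continuity in one real variable
   is enough. *)
set (phi := fun m : R => e * (ln (m ^ 2) + m ^ 2)).
assert (C : continuous phi (Cmod z)).
{ apply (ex_derive_continuous (K := R_AbsRing) (V := R_NormedModule)). unfold phi. auto_derive. nra. }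
assert (Ht2 : 0 < t / 2) by lra.
destruct (proj1 (filterlim_locally phi (phi (Cmod z))) C (mkposreal _ Ht2)) as [d2 K2].
exists (Rmin d1 d2); split; [apply Rmin_glb_lt; [exact Hd1|apply cond_pos]|].
intros h Hh. apply Rmin_Rgt in Hh. destruct Hh as [Hh1 Hh2].
specialize (K1 h Hh1).
pose proof (Cmod_shift z h) as S.
assert (B : ball (Cmod z) d2 (Cmod (z + h))).
{ change (Rabs (Cmod (z + h) - Cmod z) < d2). apply Rabs_def1; lra. }
specialize (K2 _ B). change (Rabs (phi (Cmod (z + h)) - phi (Cmod z)) < t / 2) in K2.
apply Rabs_def2 in K2.
pose proof (re_le_Cmod (G (z + h) - G z)%C) as R1.
unfold Cminus in R1. rewrite re_plus, re_opp in R1.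
apply Rabs_le_between in R1. unfold Cminus in K1.
unfold barrier. rewrite !sqmod_Cmod. unfold phi in K2. lra.
Qed.

(** If [|w a| > |a| / r], rotate [w z / z] so that its real part at [a] exceeds [1 / r]. The barrier
    is then larger at [a] than on both circles bounding a suitable annulus, so it has an interior
    maximum, against [barrier_no_max]. *)
Lemma Schwarz_lemma (w w1 : C -> C) (r : R) :
  (forall z, in_disk z -> cdiff w z (w1 z)) ->
  (forall z, in_disk z -> exists l, cdiff (fun x => x * w1 x)%C z l) ->
  w 0 = 0 -> 0 < r < 1 -> (forall z, Cmod z <= r -> Cmod (w z) <= 1) ->
  forall z, Cmod z <= r -> Cmod (w z) <= Cmod z / r.
Proof.
intros D DH w0 Hr B a Ha.
destruct (Req_dec (Cmod a) 0) as [Ea|Na].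
{ apply Cmod_eq_0 in Ea; subst a. rewrite w0, Cmod_0. unfold Rdiv; lra. }
assert (Pa : 0 < Cmod a) by (pose proof (Cmod_ge_0 a); lra).
assert (Na' : a <> RtoC 0) by (intros E; rewrite E, Cmod_0 in Pa; lra).
apply Rnot_lt_le; intros Hlt.
assert (Har : Cmod a < r).
{ destruct Ha as [Ha|Ha]; [exact Ha|]. rewrite Ha in Hlt. specialize (B a (Req_le _ _ Ha)).
  replace (r / r) with 1 in Hlt by (field; lra). lra. }
set (q := (w a / a)%C).
assert (Hq : / r < Cmod q).
{ unfold q. rewrite Cmod_div by exact Na'.
  apply (Rmult_lt_compat_r (/ Cmod a)) in Hlt; [|apply Rinv_0_lt_compat, Pa].
  replace (Cmod a / r * / Cmod a) with (/ r) in Hlt by (field; lra). exact Hlt. }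
assert (Ir : 0 < / r) by (apply Rinv_0_lt_compat; lra).
(* The unimodular [c] turns [q] onto the positive real axis. *)
set (c := (Cconj q / RtoC (Cmod q))%C).
assert (Nq : RtoC (Cmod q) <> RtoC 0) by (intros E; apply RtoC_inj in E; lra).
assert (Hc : Cmod c = 1).
{ unfold c. rewrite Cmod_div by exact Nq. rewrite Cmod_conj, Cmod_R, Rabs_pos_eq by lra. field; lra. }
assert (Hcq : Re (c * q)%C = Cmod q).
{ replace (c * q)%C with (RtoC (Cmod q)); [apply re_RtoC|].
  unfold c. transitivity ((q * Cconj q) / RtoC (Cmod q))%C.
  - rewrite <- Cmod2_conj. replace (Cmod q ^ 2) with (Cmod q * Cmod q) by ring.
    rewrite RtoC_mult. field. exact Nq.
  - field. exact Nq. }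
set (G := fun z => (c * (w z * / z))%C).
(* [G1] is the derivative of [G] off 0. It contains [w1] only through [z * w1 z], so [DH] makes it
   differentiable. *)
set (G1 := fun z => (c * ((z * w1 z + - w z) * (/ z * / z)))%C).
assert (DG : forall z, 0 < Cmod z < 1 -> cdiff G z (G1 z)).
{ intros z Hz.
  assert (Nz : z <> RtoC 0) by (intros E; rewrite E, Cmod_0 in Hz; lra).
  unfold G. replace (G1 z) with (0 * (w z * / z) + c * (w1 z * / z + w z * (- (/ z * / z))))%C
    by (unfold G1; field; exact Nz).
  apply (cdiff_mult (fun _ => c) (fun z => w z * / z)%C); [apply cdiff_const|].
  apply (cdiff_mult w Cinv z (w1 z) (- (/ z * / z))); [apply D; unfold in_disk; lra|apply cdiff_inv, Nz]. }
assert (DG1 : forall z, 0 < Cmod z < 1 -> exists l, cdiff G1 z l).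
{ intros z Hz.
  assert (Nz : z <> RtoC 0) by (intros E; rewrite E, Cmod_0 in Hz; lra).
  destruct (DH z) as [l Hl]; [unfold in_disk; lra|].
  eexists. unfold G1.
  apply (cdiff_mult (fun _ => c)); [apply cdiff_const|].
  apply (cdiff_mult (fun z => (z * w1 z + - w z)%C) (fun z => (/ z * / z)%C)).
  - apply (cdiff_plus (fun z => z * w1 z)%C (fun z => - w z)%C); [exact Hl|].
    apply (cdiff_ext_loc (fun z => (- (1)) * w z)%C _ _ _ 1); [lra|intros; ring|].
    apply (cdiff_mult (fun _ => (- (1))%C)); [apply cdiff_const|apply D; unfold in_disk; lra].
  - apply (cdiff_mult Cinv Cinv); apply cdiff_inv, Nz. }
assert (BG : forall z m, z <> RtoC 0 -> Cmod (w z) <= m * Cmod z -> Re (G z) <= m).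
{ intros z m Nz Hm. apply Cmod_gt_0 in Nz as Pz.
  apply Rle_trans with (Cmod (G z)); [pose proof (re_le_Cmod (G z)) as T; apply Rabs_le_between in T; lra|].
  unfold G. rewrite !Cmod_mult, Hc, Cmod_inv by exact Nz. rewrite Rmult_1_l.
  apply (Rmult_le_compat_r (/ Cmod z)) in Hm; [|left; apply Rinv_0_lt_compat, Pz].
  replace (m * Cmod z * / Cmod z) with m in Hm by (field; lra). exact Hm. }
destruct (cdiff_lip w 0 (w1 0)) as [d0 [Hd0 L0]]; [apply D; unfold in_disk; rewrite Cmod_0; lra|].
set (m := Cmod (w1 0) + 1) in *.
assert (Hm : 0 < m) by (unfold m; pose proof (Cmod_ge_0 (w1 0)); lra).
set (k0 := ln (r ^ 2) + r ^ 2 - (ln (Cmod a ^ 2) + Cmod a ^ 2)).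
assert (Hk0 : 0 < k0).
{ unfold k0. assert (Cmod a ^ 2 < r ^ 2) by nra.
  assert (ln (Cmod a ^ 2) < ln (r ^ 2)) by (apply ln_increasing; nra). lra. }
(* Passing from [|a|] to [r] raises the weight by [e * k0]. This [e] makes that half of the gap
   [|q| - 1 / r], so the outer circle, where [Re G <= 1 / r], loses to [a]. *)
set (e := (Cmod q - / r) / (2 * k0)).
assert (He : 0 < e) by (apply Rdiv_lt_0_compat; lra).
(* On the inner circle [Re G <= m]. From [del <= s] follows [e ln (del^2) <= e (ln |a|^2 - 1) - m],
   which offsets [m] and, through the [- 1], the term [e del^2]. *)
set (s := exp ((ln (Cmod a ^ 2) - 1 - m / e) / 2)).
set (del := Rmin s (Rmin (Cmod a / 2) (d0 / 2))).
assert (Hdel : 0 < del /\ del <= s /\ del <= Cmod a / 2 /\ del <= d0 / 2).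
{ unfold del. repeat split.
  - repeat apply Rmin_glb_lt; [apply exp_pos|lra|lra].
  - apply Rmin_l.
  - eapply Rle_trans; [apply Rmin_r|apply Rmin_l].
  - eapply Rle_trans; [apply Rmin_r|apply Rmin_r]. }
destruct Hdel as [Hdel [Hds [Hda Hdd]]].
assert (va : barrier G e a = Cmod q + e * (ln (Cmod a ^ 2) + Cmod a ^ 2)).
{ unfold barrier. rewrite sqmod_Cmod. f_equal. rewrite <- Hcq. reflexivity. }
destruct (EVT_plane (fun z => del <= Cmod z <= r) (barrier G e) r a) as [z [Kz Mz]].
- lra.
- intros z Hz; lra.
- intros z Hz. apply not_and_or in Hz. destruct Hz as [Hz|Hz]; apply Rnot_le_lt in Hz.
  + exists (del - Cmod z); split; [lra|]. intros h Hh [N _].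
    pose proof (Cmod_shift z h); lra.
  + exists (Cmod z - r); split; [lra|]. intros h Hh [_ N].
    pose proof (Cmod_shift z h); lra.
- intros z Hz t Ht. destruct (barrier_usc G z (G1 z) e He) with (t := t) as [d [Hd H]]; [lra|apply DG; lra|exact Ht|].
  exists d; split; [exact Hd|]. intros h Hh _; apply H, Hh.
- assert (Va : barrier G e a <= barrier G e z) by (apply Mz; lra).
  assert (Nz : z <> RtoC 0) by (intros E; rewrite E, Cmod_0 in Kz; lra).
  assert (Z1 : Cmod z < r).
  { destruct (proj2 Kz) as [H|H]; [exact H|exfalso].
    assert (Re (G z) <= / r).
    { apply BG; [exact Nz|]. rewrite H, Rinv_l by lra. apply B; lra. }
    rewrite va in Va. unfold barrier in Va. rewrite sqmod_Cmod, H in Va.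
    assert (e * k0 = (Cmod q - / r) / 2) by (unfold e; field; lra).
    unfold k0 in *. lra. }
  assert (Z2 : del < Cmod z).
  { destruct (proj1 Kz) as [H|H]; [exact H|exfalso].
    assert (Re (G z) <= m).
    { apply BG; [exact Nz|]. specialize (L0 z). rewrite w0 in L0.
      replace (0 + z)%C with z in L0 by ring. replace (w z - 0)%C with (w z) in L0 by ring.
      apply L0; lra. }
    rewrite va in Va. unfold barrier in Va. rewrite sqmod_Cmod, <- H in Va.
    assert (Ls : ln (del ^ 2) <= ln (Cmod a ^ 2) - 1 - m / e).
    { apply Rle_trans with (ln (s ^ 2)).
      - apply ln_le; [nra|]. apply pow_incr; lra.
      - unfold s. rewrite <- Rpower_pow by apply exp_pos. unfold Rpower at 1. rewrite !ln_exp. simpl; lra. }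
    assert (e * ln (del ^ 2) <= e * (ln (Cmod a ^ 2) - 1) - m).
    { apply (Rmult_le_compat_l e) in Ls; [|lra].
      replace (e * (ln (Cmod a ^ 2) - 1 - m / e)) with (e * (ln (Cmod a ^ 2) - 1) - m) in Ls by (field; lra).
      exact Ls. }
    assert (0 <= e * Cmod a ^ 2) by (apply Rmult_le_pos; nra).
    assert (e * del ^ 2 <= e * 1) by (apply Rmult_le_compat_l; nra).
    lra. }
  destruct (DG1 z) as [l Hl]; [lra|].
  apply (barrier_no_max G G1 z l (Rmin (Cmod z - del) (r - Cmod z)) e).
  + split; [apply Rmin_glb_lt; lra|]. eapply Rle_trans; [apply Rmin_l|lra].
  + exact He.
  + intros h Hh. apply Rmin_Rgt in Hh. pose proof (Cmod_shift z h). apply DG; lra.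
  + exact Hl.
  + intros h Hh. apply Rmin_Rgt in Hh. pose proof (Cmod_shift z h). apply Mz; lra.
Qed.

(** Moving from [z] to [z (1 - t (1 + i y))], the bound [|w x| <= |x| / r] forces, to first order in
    [t], [Re (L (1 + i y)) >= 1] with [L = z l / w z]. As [y] is arbitrary, [L] is real and at least
    1. *)
Lemma Jack_lemma (w : C -> C) (z l : C) (r : R) :
  0 < r -> Cmod z = r -> Cmod (w z) = 1 -> cdiff w z l ->
  (forall x, Cmod x <= r -> Cmod (w x) <= Cmod x / r) ->
  exists m : R, 1 <= m /\ (z * l = m * w z)%C.
Proof.
intros Hr Hz Hw D S.
(* [Cconj (w z)] is the inverse of [w z], since [|w z| = 1]. *)
set (L := (z * l * Cconj (w z))%C).
assert (K : forall y : R, 0 <= (Re L - 1) - y * Im L).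
{ intros y. apply Rnot_lt_le; intros Hn.
  set (g := - ((Re L - 1) - y * Im L)) in *. assert (Hg : 0 < g) by (unfold g; lra).
  assert (Hmd : Cmod (1, y) <= 1 + Rabs y).
  { replace ((1, y) : C) with (1 + y * Ci)%C by (unfold Cplus, Cmult, Ci, RtoC; simpl; f_equal; ring).
    eapply Rle_trans; [apply Cmod_triangle|]. rewrite Cmod_mult, Cmod_1, Cmod_R.
    replace (Cmod Ci) with 1; [lra|]. unfold Cmod, Ci; simpl fst; simpl snd.
    replace (0 ^ 2 + 1 ^ 2) with 1 by ring. symmetry; apply sqrt_1. }
  pose proof (Rabs_pos y) as Hy0.
  set (Y := 1 + Rabs y) in *. assert (HY : 1 <= Y) by (unfold Y; lra).
  destruct (D (g / (4 * r * Y))) as [d [Hd Dd]].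
  { apply Rdiv_lt_0_compat; [lra|]. nra. }
  (* [t <= 1/2] gives [sqrt ((1 - t)^2 + t^2 y^2) <= 1 - t + t^2 y^2]; [t y^2 <= 1] then keeps
     [z + h] in the disc of radius [r]; [t y^2 <= g / 4] controls the second-order term; [t r Y < d]
     puts [h] where the expansion holds. *)
  assert (Ht : exists t, 0 < t /\ t <= 1 / 2 /\ t * (r * Y) < d /\ t * y ^ 2 <= g / 4 /\ t * y ^ 2 <= 1).
  { assert (P1 : 0 < r * Y) by nra.
    exists (Rmin (Rmin (1 / 2) (/ (y ^ 2 + 1))) (Rmin (d / (2 * (r * Y))) (g / (4 * (y ^ 2 + 1))))).
    assert (P2 : 0 < d / (2 * (r * Y))) by (apply Rdiv_lt_0_compat; lra).
    assert (P3 : 0 < g / (4 * (y ^ 2 + 1))) by (apply Rdiv_lt_0_compat; nra).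
    assert (P4 : 0 < / (y ^ 2 + 1)) by (apply Rinv_0_lt_compat; nra).
    set (t := Rmin _ _).
    assert (T0 : 0 < t) by (unfold t; repeat apply Rmin_glb_lt; lra).
    assert (T1 : t <= d / (2 * (r * Y))) by (eapply Rle_trans; [apply Rmin_r|apply Rmin_l]).
    assert (T2 : t <= g / (4 * (y ^ 2 + 1))) by (eapply Rle_trans; [apply Rmin_r|apply Rmin_r]).
    assert (T3 : t <= 1 / 2) by (eapply Rle_trans; [apply Rmin_l|apply Rmin_l]).
    assert (T4 : t <= / (y ^ 2 + 1)) by (eapply Rle_trans; [apply Rmin_l|apply Rmin_r]).
    clearbody t.
    repeat split; [exact T0|exact T3| | |].
    - apply Rle_lt_trans with (d / (2 * (r * Y)) * (r * Y)); [apply Rmult_le_compat_r; lra|].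
      replace (d / (2 * (r * Y)) * (r * Y)) with (d / 2) by (field; split; lra). lra.
    - apply Rle_trans with (g / (4 * (y ^ 2 + 1)) * (y ^ 2 + 1)).
      + apply Rmult_le_compat; nra.
      + right; field; nra.
    - apply Rle_trans with (/ (y ^ 2 + 1) * (y ^ 2 + 1)).
      + apply Rmult_le_compat; nra.
      + right; field; nra. }
  destruct Ht as [t [Ht0 [Ht1 [Ht2 [Ht3 Ht4]]]]].
  set (h := (- (t * (z * (1, y))))%C).
  assert (Hh : Cmod h <= t * (r * Y)).
  { unfold h. rewrite Cmod_opp, !Cmod_mult, Cmod_R, Hz, Rabs_pos_eq by lra.
    apply Rmult_le_compat_l; [lra|]. apply Rmult_le_compat_l; lra. }
  assert (Hzh : (z + h)%C = (z * ((1 - t)%R, (- (t * y))%R))%C).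
  { unfold h. destruct z as [z1 z2]. unfold Cplus, Cmult, Copp, RtoC; simpl. f_equal; ring. }
  assert (Hs : t ^ 2 * y ^ 2 <= t * (g / 4)).
  { replace (t ^ 2 * y ^ 2) with (t * (t * y ^ 2)) by ring. apply Rmult_le_compat_l; lra. }
  assert (Hs1 : t ^ 2 * y ^ 2 <= t).
  { replace (t ^ 2 * y ^ 2) with (t * (t * y ^ 2)) by ring. nra. }
  assert (Hs0 : 0 <= t ^ 2 * y ^ 2) by (apply Rmult_le_pos; apply pow2_ge_0).
  assert (Hf : Cmod (z + h) <= r * (1 - t + t ^ 2 * y ^ 2)).
  { rewrite Hzh, Cmod_mult, Hz. apply Rmult_le_compat_l; [lra|].
    unfold Cmod; simpl fst; simpl snd.
    rewrite <- (sqrt_pow2 (1 - t + t ^ 2 * y ^ 2)) by lra.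
    apply sqrt_le_1_alt. nra. }
  assert (Hle : Cmod (z + h) <= r) by nra.
  specialize (S _ Hle).
  assert (Hb : Cmod (w (z + h)%C) <= 1 - t + t ^ 2 * y ^ 2).
  { eapply Rle_trans; [exact S|]. apply (Rmult_le_compat_r (/ r)) in Hf; [|left; apply Rinv_0_lt_compat, Hr].
    replace (r * (1 - t + t ^ 2 * y ^ 2) * / r) with (1 - t + t ^ 2 * y ^ 2) in Hf by (field; lra). exact Hf. }
  specialize (Dd h ltac:(lra)).
  set (E := (w (z + h) - w z - l * h)%C) in *.
  assert (HE : Cmod E <= t * (g / 4)).
  { eapply Rle_trans; [exact Dd|]. apply Rle_trans with (g / (4 * r * Y) * (t * (r * Y))).
    - apply Rmult_le_compat_l; [left; apply Rdiv_lt_0_compat; nra|exact Hh].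
    - right; field; lra. }
  assert (Eq : (Cconj (w z) * w (z + h) = 1 + (- (t * (L * (1, y)))) + Cconj (w z) * E)%C).
  { replace (RtoC 1) with (w z * Cconj (w z))%C by (rewrite <- Cmod2_conj, Hw; f_equal; ring).
    unfold E, L, h. ring. }
  pose proof (re_le_Cmod (Cconj (w z) * w (z + h))%C) as R1.
  pose proof (re_le_Cmod (Cconj (w z) * E)%C) as R2.
  rewrite Cmod_mult, Cmod_conj, Hw, Rmult_1_l in R1, R2.
  apply Rabs_le_between in R1. apply Rabs_le_between in R2.
  rewrite Eq, !re_plus, re_opp, re_scal_l, re_mult, re_RtoC in R1. simpl Re in R1 at 2. simpl Im in R1 at 2.
  set (e2 := Re (Cconj (w z) * E)%C) in *.
  change (Re (1, y)) with 1 in R1. change (Im (1, y)) with y in R1.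
  assert (t * g <= t * (g / 2)); [|nra].
  unfold g at 1. lra. }
(* An affine function of [y] that is bounded below has slope zero: the [y] chosen here would give
   [0 <= -1]. *)
assert (I0 : Im L = 0).
{ destruct (Req_dec (Im L) 0) as [H|H]; [exact H|exfalso].
  specialize (K (Re L / Im L)). replace (Re L / Im L * Im L) with (Re L) in K by (field; exact H). lra. }
exists (Re L). split; [specialize (K 0); lra|].
replace (RtoC (Re L)) with L by (destruct L; unfold RtoC; simpl in *; subst; reflexivity).
unfold L. transitivity (z * l * (w z * Cconj (w z)))%C; [|ring].
rewrite <- Cmod2_conj, Hw. replace (RtoC (1 ^ 2)) with (RtoC 1) by (f_equal; ring). ring.
Qed.

(** * The square root, tanh and the lemniscate *)

Lemma Re_sqrt_pos (s z : C) : (s * s)%C = z -> 0 < Re z -> 0 <= Re s -> 0 < Re s.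
Proof.
intros E Hz [H|H]; [exact H|exfalso].
rewrite <- E, re_mult, <- H in Hz. nra.
Qed.

(** The product [(s - Csqrt z) (s + Csqrt z)] is 0, and its second factor has positive real part. *)
Lemma Csqrt_unique (s z : C) : (s * s)%C = z -> 0 < Re z -> 0 <= Re s -> s = Csqrt z.
Proof.
intros E Hz Hs.
pose proof (Re_sqrt_pos s z E Hz Hs) as P1.
pose proof (Re_sqrt_pos _ z (Csqrt_sqr z) Hz (Csqrt_Re z)) as P2.
assert (F : ((s - Csqrt z) * (s + Csqrt z))%C = 0).
{ transitivity (s * s - Csqrt z * Csqrt z)%C; [ring|]. rewrite E, Csqrt_sqr; ring. }
assert (N : (s + Csqrt z)%C <> RtoC 0).
{ intros H; apply (f_equal Re) in H. rewrite re_plus, re_RtoC in H. lra. }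
replace s with ((s - Csqrt z) * (s + Csqrt z) / (s + Csqrt z) + Csqrt z)%C by (field; exact N).
rewrite F. field; exact N.
Qed.

(** With [s = Csqrt z] and [t = Csqrt (z + h)] the error is exactly [- h^2 / (2 s (t + s)^2)], and
    [Re t >= 0] gives [|t + s| >= Re s]. *)
Lemma Csqrt_cdiff (z : C) : 0 < Re z -> cdiff Csqrt z (/ (2 * Csqrt z)).
Proof.
intros Hz e He.
set (s := Csqrt z).
assert (P : 0 < Re s) by (apply (Re_sqrt_pos s z (Csqrt_sqr z) Hz (Csqrt_Re z))).
set (m := Re s) in *.
exists (2 * e * m ^ 3); split; [assert (0 < m ^ 3) by (apply pow_lt; exact P); nra|].
intros h Hh. set (t := Csqrt (z + h)).
assert (Ht : 0 <= Re t) by apply Csqrt_Re.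
assert (Es : (t * t - s * s)%C = h) by (unfold t, s; rewrite !Csqrt_sqr; ring).
assert (Ms : m <= Cmod s) by (pose proof (re_le_Cmod s) as T; apply Rabs_le_between in T; unfold m; lra).
assert (Mt : m <= Cmod (t + s)).
{ pose proof (re_le_Cmod (t + s)%C) as T; apply Rabs_le_between in T. rewrite re_plus in T. fold m in T. lra. }
assert (Ns : s <> RtoC 0) by (intros E; rewrite E, Cmod_0 in Ms; lra).
assert (Nt : (t + s)%C <> RtoC 0) by (intros E; rewrite E, Cmod_0 in Mt; lra).
assert (N2 : RtoC 2 <> RtoC 0) by (intros E; apply RtoC_inj in E; lra).
replace (t - s - / (2 * s) * h)%C with (- (h * h / (2 * s * ((t + s) * (t + s)))))%C
  by (rewrite <- Es; field; auto).
rewrite Cmod_opp, Cmod_div by (repeat apply Cmult_neq_0; assumption).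
rewrite !Cmod_mult, Cmod_R, Rabs_pos_eq by lra.
pose proof (Cmod_ge_0 h) as H0.
apply Rle_trans with (Cmod h * Cmod h / (2 * m * (m * m))).
- apply Rmult_le_compat_l; [nra|]. apply Rinv_le_contravar; [repeat apply Rmult_lt_0_compat; lra|].
  apply Rmult_le_compat; [nra|nra|lra|]. apply Rmult_le_compat; lra.
- apply Rle_trans with ((2 * e * m ^ 3) * Cmod h / (2 * m * (m * m))); [|right; field; lra].
  apply Rmult_le_compat_r; [left; apply Rinv_0_lt_compat; repeat apply Rmult_lt_0_compat; lra|].
  apply Rmult_le_compat_r; lra.
Qed.

Lemma Csqrt_shift_analytic : analytic_on_disk (fun z : C => Csqrt (RtoC 1 + z)%C).
Proof.
intros z Hz. exists (/ (2 * Csqrt (1 + z)))%C. apply cdiff_is_derive.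
assert (P : 0 < Re (1 + z)%C).
{ rewrite re_plus, re_RtoC. unfold in_disk in Hz. pose proof (re_le_Cmod z) as T; apply Rabs_le_between in T. lra. }
intros e He. destruct (Csqrt_cdiff _ P e He) as [d [Hd H]].
exists d; split; [exact Hd|]. intros h Hh. specialize (H h Hh).
replace (1 + (z + h))%C with (1 + z + h)%C by ring. exact H.
Qed.

Lemma Cmod_Csqrt (z : C) : Cmod (Csqrt z) ^ 2 = Cmod z.
Proof. rewrite <- (Csqrt_sqr z) at 2. rewrite Cmod_mult; ring. Qed.

Lemma cos_ge_2 (a : R) : -2 <= a <= 2 -> - (85 / 200) <= cos a.
Proof.
intros Ha.
destruct (pre_cos_bound a 1) as [H _]; [lra|lra|].
eapply Rle_trans; [|exact H].
assert (0 <= a * a <= 4) by nra.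
replace (cos_approx a (2 * 1 + 1)) with (1 - (a * a) / 2 + (a * a) ^ 2 / 24 - (a * a) ^ 3 / 720)
  by (unfold cos_approx, cos_term; simpl; field).
set (u := a * a) in *. clearbody u.
(* [u^3 <= 4 u^2] leaves a quadratic in [u], decreasing on [[0, 4]] with value about [-0.4222] at
   4. *)
assert (0 <= (4 - u) * (u ^ 2)) by (apply Rmult_le_pos; nra).
nra.
Qed.

(** Here [1 + tanh z = 2 e^z / (e^z + e^(-z))] and [|e^z + e^(-z)|^2 = e^(2x) + e^(-2x) + 2 cos
    (2y)], where [|y| <= 1] gives [cos (2y) >= -0.425]. *)
Lemma one_plus_tanh_bound (z : C) : in_disk z -> Cmod (1 + Ctanh z)%C <= 9 / 4.
Proof.
intros Hz.
destruct z as [x y].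
assert (Hy : -2 <= 2 * y <= 2).
{ unfold in_disk in Hz. pose proof (Rmax_Cmod (x, y)) as T; simpl in T.
  pose proof (Rmax_r (Rabs x) (Rabs y)). assert (T2 : Rabs y <= 1) by lra. apply Rabs_le_between in T2. lra. }
pose proof (cos_ge_2 _ Hy) as Hc. rewrite cos_2a in Hc.
pose proof (sin2_cos2 y) as Hsc. unfold Rsqr in Hsc.
unfold Ctanh. set (u := Cexp (x, y)). set (v := Cexp (- (x, y))).
assert (Hu : sqmod u = exp x ^ 2).
{ unfold u, Cexp, sqmod; simpl Re; simpl Im; simpl fst; simpl snd.
  replace ((exp x * cos y) ^ 2 + (exp x * sin y) ^ 2) with (exp x ^ 2 * (sin y * sin y + cos y * cos y)) by ring.
  rewrite Hsc; ring. }
assert (Huv : 64 * sqmod u <= 81 * sqmod (u + v)%C).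
{ rewrite Hu. unfold u, v, Cexp, sqmod, Cplus, Copp; simpl Re; simpl Im; simpl fst; simpl snd.
  rewrite cos_neg, sin_neg, exp_Ropp.
  set (E := exp x). assert (HE : 0 < E) by apply exp_pos.
  set (F := / E). assert (HF : E * F = 1) by (unfold F; field; lra).
  clearbody E F.
  replace ((E * cos y + F * cos y) ^ 2 + (E * sin y + F * - sin y) ^ 2) with
    ((E ^ 2 + F ^ 2) * (sin y * sin y + cos y * cos y) + 2 * (E * F) * (cos y * cos y - sin y * sin y)) by ring.
  rewrite Hsc, HF.
  (* The middle coefficient is [81 * 2 * 0.425]. The square with [81 / 40] reproduces this cross
     term, and [17 (81/40)^2 < 81]. *)
  assert (0 <= 17 * E ^ 2 - 6885 / 100 * (E * F) + 81 * F ^ 2)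
    by (pose proof (pow2_ge_0 (E - 81 / 40 * F)); pose proof (pow2_ge_0 F); nra).
  rewrite HF in *. lra. }
rewrite !sqmod_Cmod in Huv. rewrite sqmod_Cmod in Hu.
assert (Pu : 0 < Cmod u) by (pose proof (exp_pos x); pose proof (Cmod_ge_0 u); nra).
pose proof (Cmod_ge_0 (u + v)%C) as P0.
assert (Puv : 8 * Cmod u <= 9 * Cmod (u + v)) by nra.
assert (N : (u + v)%C <> RtoC 0) by (intros E; rewrite E, Cmod_0 in Puv; lra).
replace (1 + (u - v) / (u + v))%C with (2 * u / (u + v))%C by (field; exact N).
rewrite Cmod_div, Cmod_mult, Cmod_R, Rabs_pos_eq by (exact N || lra).
apply Rle_div_l; lra.
Qed.

Lemma sqrt_tanh_bound (z : C) : in_disk z -> Cmod (Csqrt (1 + Ctanh z)) <= 3 / 2.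
Proof.
intros Hz. pose proof (one_plus_tanh_bound z Hz) as H. rewrite <- Cmod_Csqrt in H.
pose proof (Cmod_ge_0 (Csqrt (1 + Ctanh z))). nra.
Qed.

(** [2 E^2 / (1 + E^2)] increases with [E > 0], so [e >= 5/2] is enough. Together with the 0.19
    gained in [lemniscate_estimate], 1.312 exceeds [3/2]. *)
Lemma R_tanh_lower : 1312 / 1000 <= R_tanh.
Proof.
unfold R_tanh.
assert (He : 5 / 2 <= exp 1).
(* [exp (1/8) >= 9/8], squared three times. *)
{ pose proof (exp_ineq1_le (1 / 8)) as H.
  replace 1 with (1 / 8 + 1 / 8 + (1 / 8 + 1 / 8) + (1 / 8 + 1 / 8 + (1 / 8 + 1 / 8))) by lra.
  rewrite !exp_plus. set (u := exp (1 / 8)) in *. clearbody u.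
  assert (81 / 64 <= u * u) by nra. set (v := u * u) in *. clearbody v.
  assert (6561 / 4096 <= v * v) by nra. set (t := v * v) in *. clearbody t. nra. }
set (E := exp 1) in *. clearbody E.
assert (P : 0 <= 2 / (1 + E ^ 2)) by (left; apply Rdiv_lt_0_compat; nra).
pose proof (sqrt_pos (2 / (1 + E ^ 2))) as S0. pose proof (sqrt_sqrt _ P) as S1.
set (q := sqrt (2 / (1 + E ^ 2))) in *. clearbody q.
assert (S2 : (q * q) * (1 + E ^ 2) = 2) by (rewrite S1; field; nra).
assert (S3 : (E * q) ^ 2 >= (1312 / 1000) ^ 2).
{ assert (q * q * (1 + E ^ 2) * (1312 / 1000) ^ 2 <= 2 * (E * q) ^ 2); [|nra].
  assert ((1 + E ^ 2) * (1312 / 1000) ^ 2 <= 2 * E ^ 2) by nra.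
  assert (0 <= q * q) by nra.
  replace (2 * (E * q) ^ 2) with (q * q * (2 * E ^ 2)) by ring.
  rewrite Rmult_assoc. apply Rmult_le_compat_l; assumption. }
assert (0 <= E * q) by nra. nra.
Qed.

Lemma sqrt2_bounds : 1414 / 1000 <= sqrt 2 /\ sqrt 2 * sqrt 2 = 2.
Proof.
assert (S : sqrt 2 * sqrt 2 = 2) by (apply sqrt_sqrt; lra).
split; [|exact S]. pose proof (sqrt_pos 2). nra.
Qed.

Lemma Cmod_le_sqmod (z : C) (b : R) : 0 <= b -> sqmod z <= b ^ 2 -> Cmod z <= b.
Proof. intros Hb H. rewrite sqmod_Cmod in H. pose proof (Cmod_ge_0 z). nra. Qed.

Lemma sqmod_sub (u v : C) (s : R) :
  sqmod (u - s * v)%C = sqmod u - 2 * s * Re (Cconj u * v)%C + s ^ 2 * sqmod v.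
Proof. destruct u, v; unfold sqmod; simpl; ring. Qed.

(** [P] lies on the right loop of the lemniscate of Bernoulli, where [rho = |P|^2] determines [x^2]
    and [y^2]. One common shift by a nonnegative multiple of [(P^2 - 1) Cconj P^j] brings both
    moduli 0.19 below the maxima [sqrt 2] and [2] of [|P|] and [|P^2|]. *)
Lemma lemniscate_estimate (P : C) (j : nat) :
  Cmod (P * P - 1)%C = 1 -> 0 <= Re P -> (j <= 2)%nat ->
  exists s, 0 <= s /\
    Cmod (P - s * ((P * P - 1) * Cconj P ^ j))%C <= sqrt 2 - 19 / 100 /\
    Cmod (P * P - s * ((P * P - 1) * Cconj P ^ j))%C <= 2 - 19 / 100.
Proof.
intros Hz Hx Hj.
assert (L : sqmod (P * P - 1)%C = 1) by (rewrite sqmod_Cmod, Hz; ring).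
destruct sqrt2_bounds as [S2 _].
destruct P as [x y]. simpl in Hx.
set (rho := x ^ 2 + y ^ 2).
unfold sqmod, Cmult, Cminus, Cplus, Copp in L; simpl fst in L; simpl snd in L.
assert (Q : x ^ 2 = rho / 2 + rho ^ 2 / 4) by (unfold rho; nra).
assert (Q' : y ^ 2 = rho / 2 - rho ^ 2 / 4) by (unfold rho; nra).
assert (R0 : 0 <= rho) by (unfold rho; nra).
assert (R2 : rho <= 2) by nra.
assert (Y : forall n, y ^ (S (S n)) = y ^ n * y ^ 2) by (intros; simpl; ring).
(* Since [1.498 <= (1.414 - 0.19)^2], up to this value [P] itself is small enough. *)
destruct (Rle_dec rho (1498 / 1000)) as [Hr|Hr].
- exists 0. split; [lra|].
  split; apply Cmod_le_sqmod; try lra.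
  + replace (sqmod _) with rho; [nra|]. unfold sqmod, rho; simpl; ring.
  + replace (sqmod _) with (rho ^ 2); [nra|]. unfold sqmod, rho; simpl; ring.
- apply Rnot_le_lt in Hr.
  assert (X : 1144 / 1000 <= x) by nra.
  (* The value [2 / 5] serves for every [j] and for both estimates; [sqmod_sub] turns each into a
     polynomial inequality in [rho] and [x]. *)
  exists (2 / 5). split; [lra|].
  set (z := ((x, y) * (x, y) - 1)%C) in *.
  assert (V : sqmod (z * Cconj (x, y) ^ j)%C = rho ^ j).
  { rewrite sqmod_Cmod, Cmod_mult, Cmod_pow, Cmod_conj. rewrite Hz, Rmult_1_l.
    rewrite <- pow_mult, Nat.mul_comm, pow_mult, <- sqmod_Cmod. reflexivity. }
  assert (U1 : sqmod (x, y) = rho) by reflexivity.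
  assert (U2 : sqmod ((x, y) * (x, y))%C = rho ^ 2) by (unfold sqmod, rho; simpl; ring).
  assert (Q3 : x ^ 2 - y ^ 2 = rho ^ 2 / 2) by lra.
  assert (Q4 : x ^ 2 - 3 * y ^ 2 = rho ^ 2 - rho) by lra.
  assert (Q5 : x ^ 2 + y ^ 2 = rho) by reflexivity.
  split; apply Cmod_le_sqmod; try lra; rewrite sqmod_sub, V, ?U1, ?U2.
  + apply Rle_trans with (1498 / 1000); [|nra].
    destruct j as [|[|[|]]]; [| | |lia].
    * replace (Re _) with ((x ^ 2 + y ^ 2) * x - x) by (unfold z; simpl; ring).
      rewrite Q5. nra.
    * replace (Re _) with ((x ^ 2 + y ^ 2) ^ 2 - (x ^ 2 - y ^ 2)) by (unfold z; simpl; ring).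
      rewrite Q5, Q3. nra.
    * replace (Re _) with ((x ^ 2 + y ^ 2) ^ 2 * x - x * (x ^ 2 - 3 * y ^ 2)) by (unfold z; simpl; ring).
      rewrite Q5, Q4. nra.
  + replace ((2 - 19 / 100) ^ 2) with (32761 / 10000) by field.
    destruct j as [|[|[|]]]; [| | |lia].
    * replace (Re _) with ((x ^ 2 + y ^ 2) ^ 2 - (x ^ 2 - y ^ 2)) by (unfold z; simpl; ring).
      rewrite Q5, Q3. nra.
    * replace (Re _) with ((x ^ 2 + y ^ 2) ^ 2 * x - x * (x ^ 2 - 3 * y ^ 2)) by (unfold z; simpl; ring).
      rewrite Q5, Q4. nra.
    * replace (Re _) with ((x ^ 2 + y ^ 2) ^ 2 * (x ^ 2 - y ^ 2) - (2 * (x ^ 2 - y ^ 2) ^ 2 - (x ^ 2 + y ^ 2) ^ 2))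
        by (unfold z; simpl; ring).
      rewrite Q5, Q3. nra.
Qed.

(** * The first boundary point *)

(** Here [j] stands for [k + 1]. A term [s W] is moved from the part without [beta] to the part with
    [beta]: the former drops 0.19 below [2 alpha + (1 - alpha) sqrt 2], the latter keeps its lower
    bound. *)
Lemma boundary_value_bound (alpha m : R) (beta P : C) (j : nat) :
  0 <= alpha <= 1 -> 1 <= m -> 0 < Re beta -> (j <= 2)%nat ->
  Cmod (P * P - 1)%C = 1 -> 0 <= Re P -> P <> RtoC 0 ->
  Cmod beta >= (R_tanh + 2 * alpha + (1 - alpha) * sqrt 2) * (2 * sqrt 2 ^ j) ->
  3 / 2 < Cmod (RtoC (1 - alpha) * P + RtoC alpha * P ^ 2
                + beta * (RtoC m * (P * P - 1) / (2 * P ^ j)))%C.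
Proof.
intros Ha Hm Hb Hj Hz HP NP HB.
destruct (lemniscate_estimate P j Hz HP Hj) as [s [Hs [E1 E2]]].
destruct sqrt2_bounds as [S1 S2].
pose proof R_tanh_lower as HR.
set (z := (P * P - 1)%C) in *.
assert (N2 : RtoC 2 <> RtoC 0) by (intros E; apply RtoC_inj in E; lra).
assert (NPj : (P ^ j)%C <> RtoC 0) by (apply Cpow_nz, NP).
assert (PP : 0 < Cmod P) by (apply Cmod_gt_0, NP).
assert (P2 : Cmod P <= sqrt 2).
{ assert (Cmod (P * P) <= 2).
  { replace (P * P)%C with (z + 1)%C by (unfold z; ring).
    eapply Rle_trans; [apply Cmod_triangle|]. rewrite Hz, Cmod_1; lra. }
  rewrite Cmod_mult in H. pose proof (sqrt_pos 2). nra. }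
set (q := Cmod P ^ j). assert (Hq : 0 < q) by (apply pow_lt, PP).
assert (Hq2 : q <= sqrt 2 ^ j) by (apply pow_incr; lra).
(* As [P^j * Cconj P^j = q^2], the term [s W] below equals [t (z / P^j)], so it can be absorbed in
   the coefficient of [z / P^j]. *)
set (t := s * q ^ 2). assert (Ht : 0 <= t) by (unfold t; nra).
set (A := (RtoC (1 - alpha) * P + RtoC alpha * P ^ 2)%C).
assert (CP : (P ^ j * Cconj P ^ j)%C = RtoC (q ^ 2)).
{ rewrite <- Cpow_mult_l, <- Cmod2_conj, <- RtoC_pow. f_equal. unfold q.
  rewrite <- !pow_mult. f_equal; lia. }
set (W := (z * Cconj P ^ j)%C) in *.
replace (A + beta * (RtoC m * z / (2 * P ^ j)))%C with
  ((A - s * W) + (beta * (m / 2)%R + t) * (z / P ^ j))%C.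
2:{ unfold t, W. rewrite RtoC_mult, <- CP, RtoC_div by lra. field. auto. }
assert (LA : Cmod (A - s * W)%C <= (1 - alpha) * (sqrt 2 - 19 / 100) + alpha * (2 - 19 / 100)).
{ replace (A - s * W)%C with (RtoC (1 - alpha) * (P - s * W) + RtoC alpha * (P * P - s * W))%C
    by (unfold A; rewrite RtoC_minus; ring).
  eapply Rle_trans; [apply Cmod_triangle|]. rewrite !Cmod_mult, !Cmod_R, !Rabs_pos_eq by lra.
  apply Rplus_le_compat; apply Rmult_le_compat_l; lra. }
set (k := R_tanh + 2 * alpha + (1 - alpha) * sqrt 2) in *.
assert (Hk : 0 < k) by (unfold k; nra).
(* As [Re beta > 0] and [t >= 0], adding [t] does not decrease the modulus. *)
assert (LB : Cmod beta / 2 <= Cmod (beta * (m / 2)%R + t)%C).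
{ pose proof (Cmod_ge_0 (beta * (m / 2)%R + t)%C) as G0. pose proof (Cmod_ge_0 beta) as G1.
  pose proof (sqmod_Cmod (beta * (m / 2)%R + t)%C) as Q1. pose proof (sqmod_Cmod beta) as Q2.
  assert (Q3 : sqmod beta / 4 <= sqmod (beta * (m / 2)%R + t)%C).
  { destruct beta as [u v]. simpl in Hb. unfold sqmod; simpl.
    assert (0 <= u * m * t) by (repeat apply Rmult_le_pos; lra).
    assert (0 <= (m * m - 1) * (u * u + v * v)) by (apply Rmult_le_pos; nra).
    nra. }
  nra. }
assert (LT : k <= Cmod ((beta * (m / 2)%R + t) * (z / P ^ j))%C).
{ rewrite Cmod_mult, Cmod_div, Hz, Cmod_pow by exact NPj. fold q.
  apply Rle_trans with (k * q * (1 / q)); [right; field; lra|].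
  apply Rmult_le_compat_r; [left; apply Rdiv_lt_0_compat; lra|].
  assert (k * q <= k * sqrt 2 ^ j) by (apply Rmult_le_compat_l; lra). lra. }
(* The difference of the two bounds is at least [R_tanh + 0.19 >= 1.502]. *)
pose proof (Cmod_shift ((beta * (m / 2)%R + t) * (z / P ^ j))%C (A - s * W)%C) as [L _].
rewrite (Cplus_comm (A - s * W)). unfold k in *. lra.
Qed.

(** Along the segment [Re p] starts at 1; where it vanishes, [p^2 <= 0] and [|p^2 - 1| >= 1].
    Leaving [t = 1] out of the hypothesis admits a boundary point [z] with [|p(z)^2 - 1| = 1]. *)
Lemma segment_Re_nonneg (p : C -> C) (z : C) :
  (forall x, in_disk x -> exists l, cdiff p x l) -> p 0 = 1 -> in_disk z ->
  (forall t : R, 0 <= t < 1 -> Cmod (p (t * z) * p (t * z) - 1)%C < 1) ->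
  0 <= Re (p z).
Proof.
intros D p0 Hz H. apply Rnot_lt_le; intros N.
destruct (IVT_interv (fun t : R => - Re (p (0 + t * z)%C)) 0 1) as [t [Ht E]].
- intros t Ht.
  destruct (D (0 + t * z)%C) as [l Hl].
  { unfold in_disk. replace (0 + t * z)%C with (t * z)%C by ring.
    rewrite Cmod_mult, Cmod_R, Rabs_pos_eq by lra. pose proof (Cmod_ge_0 z). unfold in_disk in Hz. nra. }
  apply derivable_continuous_pt, (derivable_pt_opp (fun t : R => Re (p (0 + t * z)%C))).
  exists (Re (l * z)%C). apply is_derive_Reals, cdiff_dir, Hl.
- lra.
- replace (0 + 0%R * z)%C with (RtoC 0) by ring. rewrite p0, re_RtoC. lra.
- replace (0 + 1%R * z)%C with z by ring. lra.
- replace (0 + t * z)%C with (t * z)%C in E by ring.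
  assert (T1 : t <> 1). { intros ->. replace (1%R * z)%C with z in E by ring. lra. }
  specialize (H t ltac:(lra)).
  set (q := p (t * z)%C) in *.
  pose proof (re_le_Cmod (q * q - 1)%C) as R1. apply Rabs_le_between in R1.
  unfold Cminus in R1, H. rewrite re_plus, re_opp, re_mult, re_RtoC in R1.
  replace (Re q) with 0 in R1 by lra. nra.
Qed.

(** A point of smallest modulus in the compact set [|w| >= 1], [|z| <= |a|], found by maximizing
    [- Cmod]. *)
Lemma first_boundary_point (w : C -> C) :
  (forall z, in_disk z -> exists l, cdiff w z l) -> w 0 = 0 ->
  ~ (forall z, in_disk z -> in_disk (w z)) ->
  exists z, in_disk z /\ 0 < Cmod z /\ Cmod (w z) = 1 /\
    (forall x, Cmod x < Cmod z -> Cmod (w x) < 1) /\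
    (forall x, Cmod x <= Cmod z -> Cmod (w x) <= 1).
Proof.
intros D w0 N.
apply not_all_ex_not in N. destruct N as [a N]. apply imply_to_and in N. destruct N as [Ha Hwa].
unfold in_disk in Ha, Hwa. apply Rnot_lt_le in Hwa.
destruct (EVT_plane (fun z => Cmod z <= Cmod a /\ 1 <= Cmod (w z)) (fun z => - Cmod z) (Cmod a) a) as [z [[Kz Kw] Mz]].
- lra.
- intros z Hz; lra.
- intros z Hz. destruct (Rle_dec (Cmod z) (Cmod a)) as [H|H].
  + assert (Hw : Cmod (w z) < 1) by (apply Rnot_le_lt; tauto).
    destruct (D z) as [l Hl]; [unfold in_disk; lra|].
    destruct (cdiff_cont w z l Hl (1 - Cmod (w z))) as [d [Hd K]]; [lra|].
    exists d; split; [exact Hd|]. intros h Hh [_ G]. specialize (K h Hh).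
    pose proof (Cmod_shift (w z) (w (z + h) - w z)%C) as [_ S].
    replace (w z + (w (z + h) - w z))%C with (w (z + h)%C) in S by ring. lra.
  + exists (Cmod z - Cmod a); split; [lra|]. intros h Hh [G _].
    pose proof (Cmod_shift z h); lra.
- intros z _ e He. exists e; split; [exact He|]. intros h Hh _.
  pose proof (Cmod_shift z h); lra.
- assert (B1 : forall x, Cmod x < Cmod z -> Cmod (w x) < 1).
  { intros x Hx. apply Rnot_le_lt; intros G. specialize (Mz x). lra. }
  assert (Hz : 0 < Cmod z).
  { destruct (Req_dec (Cmod z) 0) as [E|E]; [|pose proof (Cmod_ge_0 z); lra].
    apply Cmod_eq_0 in E. rewrite E, w0, Cmod_0 in Kw. lra. }
  assert (B2 : forall x, Cmod x <= Cmod z -> Cmod (w x) <= 1).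
  { intros x Hx. destruct Hx as [Hx|Hx]; [left; apply B1, Hx|].
    apply Rnot_lt_le; intros G.
    destruct (D x) as [l Hl]; [unfold in_disk; lra|].
    destruct (cdiff_cont w x l Hl (Cmod (w x) - 1)) as [d [Hd K]]; [lra|].
    (* If [|w x| > 1] on the circle, then by continuity also at [(1 - t) x], strictly inside,
       against [B1]. *)
    set (t := Rmin (1 / 2) (d / 2)).
    assert (Ht : 0 < t) by (apply Rmin_glb_lt; lra).
    assert (Ht1 : t <= 1 / 2) by apply Rmin_l. assert (Ht2 : t <= d / 2) by apply Rmin_r.
    assert (Hh : Cmod (- (t * x))%C = t * Cmod x).
    { rewrite Cmod_opp, Cmod_mult, Cmod_R, Rabs_pos_eq; lra. }
    specialize (K (- (t * x))%C ltac:(nra)).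
    pose proof (Cmod_shift (w x) (w (x + - (t * x)) - w x)%C) as [S _].
    replace (w x + (w (x + - (t * x)) - w x))%C with (w (x + - (t * x))%C) in S by ring.
    assert (Cmod (w (x + - (t * x))%C) < 1); [|lra].
    apply B1. replace (x + - (t * x))%C with ((1 - t)%R * x)%C by (rewrite RtoC_minus; ring).
    rewrite Cmod_mult, Cmod_R, Rabs_pos_eq by lra. nra. }
  exists z. unfold in_disk. repeat split; [lra|exact Hz| |exact B1|exact B2].
  apply Rle_antisym; [apply B2; lra|exact Kw].
Qed.

(** * The power of 2, the quotient by [p^k], and the conclusion *)

Lemma Rpower_two_half (j : nat) : Rpower 2 ((INR j + 2) / 2) = 2 * sqrt 2 ^ j.
Proof.
replace ((INR j + 2) / 2) with (1 + (/ 2) * INR j) by field.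
rewrite Rpower_plus, Rpower_1, <- Rpower_mult, Rpower_sqrt, Rpower_pow by (try apply sqrt_lt_R0; lra).
reflexivity.
Qed.

Lemma cdiff_C_derive (f : C -> C) : analytic_on_disk f ->
  forall z, in_disk z -> cdiff f z (C_derive f z).
Proof. intros H z Hz. apply cdiff_is_derive. apply C_derive_correct; [exact z|apply H, Hz]. Qed.

Lemma Cinv_0 : (/ RtoC 0)%C = RtoC 0.
Proof. apply injective_projections; simpl; unfold Rdiv; ring. Qed.

(* With [j = k + 1], the quotient by [p ^ k] is cleared; the junk values at zeros of [p] agree. *)
Lemma div_CpowZ (x P : C) (k : Z) (j : nat) : (k = -1 \/ k = 0 \/ k = 1)%Z -> Z.of_nat j = (k + 1)%Z ->
  (P ^ j * (x / CpowZ P k) = x * P)%C.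
Proof.
intros Hk Hj.
destruct Hk as [-> | [-> | ->]].
- assert (j = 0)%nat as -> by lia. simpl.
  destruct (Ceq_dec P 0) as [->|N].
  + rewrite Cmult_0_l. unfold Cdiv. rewrite !Cinv_0. ring.
  + field. exact N.
- assert (j = 1)%nat as -> by lia. simpl. field.
- assert (j = 2)%nat as -> by lia. simpl.
  destruct (Ceq_dec P 0) as [->|N]; [ring|field; exact N].
Qed.

Theorem theorem3p4 (alpha : R) (k : Z) (beta : C) (p : C -> C)
  (halpha : 0 <= alpha <= 1)
  (hk : k = (-1)%Z \/ k = 0%Z \/ k = 1%Z)
  (hbeta0 : beta <> RtoC 0)
  (hbetaRe : 0 < Re beta)
  (hp : analytic_on_disk p)
  (hp0 : p (RtoC 0) = RtoC 1)
  (hsub : subordinate (lhs alpha beta k p)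
                      (fun z : C => Csqrt (RtoC 1 + Ctanh z)%C))
  (hbeta : Cmod beta >=
             (R_tanh + 2 * alpha + (1 - alpha) * sqrt 2)
             * Rpower 2 ((IZR k + 3) / 2)) :
  subordinate p (fun z : C => Csqrt (RtoC 1 + z)%C).
Proof.
pose proof (cdiff_C_derive p hp) as Dp.
assert (Dp' : forall z, in_disk z -> exists l, cdiff p z l) by (intros z Hz; eexists; apply Dp, Hz).
set (w := fun z => (p z * p z - 1)%C).
set (w1 := fun z => (2 * (p z * C_derive p z))%C).
assert (Dw : forall z, in_disk z -> cdiff w z (w1 z)).
{ intros z Hz. replace (w1 z) with (C_derive p z * p z + p z * C_derive p z + 0)%C by (unfold w1; ring).
  apply (cdiff_plus (fun z => p z * p z)%C (fun _ => - (1))%C); [|apply cdiff_const].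
  apply (cdiff_mult p p); apply Dp, Hz. }
assert (w0 : w 0 = 0) by (unfold w; rewrite hp0; ring).
assert (Hj : exists j : nat, (j <= 2)%nat /\ Z.of_nat j = (k + 1)%Z).
{ exists (Z.to_nat (k + 1)). lia. }
destruct Hj as [j [Hj2 Hjk]].
assert (Hpow : Rpower 2 ((IZR k + 3) / 2) = 2 * sqrt 2 ^ j).
{ rewrite <- Rpower_two_half. f_equal. rewrite INR_IZR_INZ, Hjk, plus_IZR. field. }
rewrite Hpow in hbeta.
destruct hsub as [hlhs [_ [om [_ [hom [_ heq]]]]]].
assert (Dl := cdiff_C_derive _ hlhs).
(* The right-hand side contains [p] and [lhs] but no explicit derivative, so [z * w1 z] inherits
   their differentiability; by [div_CpowZ] the identity holds at zeros of [p] as well. *)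
assert (Hzw : forall z, (z * w1 z = 2 / beta * (p z ^ j * (lhs alpha beta k p z
    + - (RtoC (1 - alpha) * p z + RtoC alpha * (p z * p z)))))%C).
{ intros z. unfold lhs, w1.
  transitivity (2 / beta * (beta * (p z ^ j * ((z * C_derive p z) / CpowZ (p z) k))))%C; [|ring].
  rewrite (div_CpowZ _ _ _ _ hk Hjk). field. exact hbeta0. }
assert (DH : forall z, in_disk z -> exists l, cdiff (fun x => x * w1 x)%C z l).
{ intros z Hz.
  assert (Dpow : exists l, cdiff (fun x => p x ^ j)%C z l).
  { clear - Dp' Hz. induction j as [|j [l IH]]; simpl.
    - eexists; apply cdiff_const.
    - destruct (Dp' z Hz) as [m Hm]. eexists. apply (cdiff_mult p (fun x => p x ^ j)%C); eassumption. }
  destruct Dpow as [l1 Hl1].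
  destruct (Dp' z Hz) as [l2 Hl2].
  eexists.
  apply (cdiff_ext_loc (fun x => 2 / beta * (p x ^ j * (lhs alpha beta k p x
    + (- (RtoC 1) * (RtoC (1 - alpha) * p x + RtoC alpha * (p x * p x))))))%C _ _ _ 1); [lra| |].
  { intros h _. rewrite Hzw. ring. }
  apply (cdiff_mult (fun _ => 2 / beta)%C); [apply cdiff_const|].
  apply (cdiff_mult (fun x => p x ^ j)%C); [exact Hl1|].
  apply (cdiff_plus (lhs alpha beta k p)); [apply Dl, Hz|].
  apply (cdiff_mult (fun _ => - RtoC 1)%C); [apply cdiff_const|].
  apply (cdiff_plus (fun x => RtoC (1 - alpha) * p x)%C (fun x => RtoC alpha * (p x * p x))%C).
  - apply (cdiff_mult (fun _ => RtoC (1 - alpha)) p); [apply cdiff_const|exact Hl2].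
  - apply (cdiff_mult (fun _ => RtoC alpha) (fun x => p x * p x)%C); [apply cdiff_const|].
    apply (cdiff_mult p p); exact Hl2. }
assert (W : forall z, in_disk z -> in_disk (w z)).
{ apply NNPP; intros N.
  destruct (first_boundary_point w) as [z [Hz [Hz0 [Hwz [B1 B2]]]]]; [intros x Hx; eexists; apply Dw, Hx|exact w0|exact N|].
  unfold in_disk in Hz.
  pose proof (Schwarz_lemma w w1 (Cmod z) Dw DH w0 (conj Hz0 Hz) B2) as S.
  destruct (Jack_lemma w z (w1 z) (Cmod z) Hz0 eq_refl Hwz (Dw z Hz) S) as [m [Hm Em]].
  assert (Nw : w z <> RtoC 0) by (intros E; rewrite E, Cmod_0 in Hwz; lra).
  (* A zero of [p] at [z] would make [w1 z], hence [m * w z], vanish, but the latter has modulus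
     [m >= 1]. *)
  assert (Np : p z <> RtoC 0).
  { intros E. unfold w1 in Em. rewrite E in Em.
    assert (F : (m * w z)%C = RtoC 0) by (rewrite <- Em; ring).
    apply (f_equal Cmod) in F. rewrite Cmod_mult, Cmod_R, Cmod_0, Hwz, Rabs_pos_eq in F; lra. }
  assert (RP : 0 <= Re (p z)).
  { apply segment_Re_nonneg; [exact Dp'|exact hp0|exact Hz|].
    intros t Ht. apply B1. rewrite Cmod_mult, Cmod_R, Rabs_pos_eq by lra. nra. }
  (* The value of [lhs] at [z] would exceed [3/2], while subordination makes it a value of
     [sqrt (1 + tanh)] on the disk. *)
  pose proof (boundary_value_bound alpha m beta (p z) j halpha Hm hbetaRe Hj2 Hwz RP Np hbeta) as Low.
  pose proof (sqrt_tanh_bound (om z) (hom z Hz)) as Up.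
  rewrite <- heq in Up by exact Hz. revert Up. apply Rlt_not_le.
  replace (lhs alpha beta k p z) with
   (RtoC (1 - alpha) * p z + RtoC alpha * p z ^ 2 + beta * (RtoC m * (p z * p z - 1) / (2 * p z ^ j)))%C; [exact Low|].
  unfold lhs. do 2 f_equal.
  assert (NPj : (p z ^ j)%C <> RtoC 0) by (apply Cpow_nz, Np).
  assert (N2 : RtoC 2 <> RtoC 0) by (intros E; apply RtoC_inj in E; lra).
  change (p z * p z - 1)%C with (w z). rewrite <- Em. unfold w1.
  transitivity ((z * C_derive p z * p z) / p z ^ j)%C; [field; auto|].
  rewrite <- (div_CpowZ _ _ _ _ hk Hjk).
  generalize (z * C_derive p z / CpowZ (p z) k)%C; intros v. field; exact NPj. }
split; [exact hp|]. split; [exact Csqrt_shift_analytic|].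
exists w. split; [intros z Hz; eexists; apply cdiff_is_derive, Dw, Hz|].
split; [exact W|]. split; [exact w0|].
(* [p z] is a square root of [1 + w z], and [Re (p z) >= 0] makes it the principal one. *)
intros z Hz. apply Csqrt_unique.
- unfold w; ring.
- specialize (W z Hz). unfold in_disk in W. pose proof (re_le_Cmod (w z)) as T. apply Rabs_le_between in T.
  rewrite re_plus, re_RtoC. lra.
- apply segment_Re_nonneg; [exact Dp'|exact hp0|exact Hz|].
  intros t Ht. apply W. unfold in_disk in *. rewrite Cmod_mult, Cmod_R, Rabs_pos_eq by lra.
  pose proof (Cmod_ge_0 z). nra.
Qed.
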